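(* (1) For every positive integer $\alpha$ and every integer $F>3\alpha+3$ with $F\equiv\alpha \pmod 2$, $$T_1(F,\alpha)\geq 2^{\frac{F}{6}-\frac{\alpha}{2}}.$$ (2) For every integer $\alpha\geq 2$ and every real $\epsilon>0$, for all sufficiently large integers $F$, $$T(F,\alpha)>2^{(0.1-\epsilon)F}.$$ Here $T(F,t)$ is the number of numerical semigroups with Frobenius number $F$ and type $t$, and $T_1(F,t)$ is the number of almost symmetric numerical semigroups with Frobenius number $F$ and type $t$.
   Context: $\mathbb{N}=\{0,1,2,\dots\}$. A numerical semigroup is a subset $S\subseteq\mathbb{N}$ containing $0$, closed under addition, with finite complement in $\mathbb{N}$. The elements of $\mathbb{N}\setminus S$ are the gaps of $S$; the genus $g(S)$ is the number of gaps; for $S\neq\mathbb{N}$ the Frobenius number $F(S)$ is the largest gap. The set of pseudo-Frobenius numbers is $PF(S)=\{x\in\mathbb{N}\setminus S \mid x+s\in S \text{ for all } s\in S\setminus\{0\}\}$, and the type is $t(S)=|PF(S)|$. $S$ is almost symmetric if $t(S)=2g(S)-F(S)$. *)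

(* Defs.v *)
From HB Require Import structures.
From mathcomp Require Import all_boot all_order all_algebra finmap.
From mathcomp Require Import all_classical all_reals all_analysis.

Set Implicit Arguments.
Unset Strict Implicit.
Unset Printing Implicit Defensive.

Import Order.TTheory GRing.Theory Num.Theory.

Local Open Scope classical_set_scope.

Definition gaps (S : set nat) : set nat := ~` S.

Definition numerical_semigroup (S : set nat) : Prop :=
  [/\ S 0%N, forall x y, S x -> S y -> S (x + y)%N & finite_set (gaps S)].

(* [fset_set A] is the finite set with the elements of [A] when [A] is finite,
   and is empty otherwise; it is only used below on finite sets. *)
Definition ncard (T : choiceType) (A : set T) : nat := #|` fset_set A|%fset.

Definition genus (S : set nat) : nat := ncard (gaps S).

(* Meaningful only for a numerical semigroup S <> setT, see [frobeniusP];
   the junk value for S = setT is 0. *)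
Definition frobenius (S : set nat) : nat := \max_(x <- fset_set (gaps S)) x.

Definition pseudo_frobenius (S : set nat) : set nat :=
  [set x | gaps S x /\ forall s, S s -> s <> 0%N -> S (x + s)%N].

Definition semigroup_type (S : set nat) : nat := ncard (pseudo_frobenius S).

(* The equation is in [int], so that the subtraction is not truncated. *)
Definition almost_symmetric (S : set nat) : Prop :=
  ((semigroup_type S)%:Z = 2 * (genus S)%:Z - (frobenius S)%:Z)%R.

(* The condition S <> setT says that the Frobenius number of S exists. *)
Definition semigroups_FT (F t : nat) : set (set nat) :=
  [set S | [/\ numerical_semigroup S, S <> setT, frobenius S = F
             & semigroup_type S = t]].

Definition T (F t : nat) : nat := ncard (semigroups_FT F t).

Definition T1 (F t : nat) : nat :=
  ncard (semigroups_FT F t `&` [set S | almost_symmetric S]).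

(* Checks that the sets whose cardinals are taken above are finite, and that
   [frobenius S] is the largest gap. *)

Lemma frobeniusP (S : set nat) : numerical_semigroup S -> S <> setT ->
  gaps S (frobenius S) /\ forall x, gaps S x -> (x <= frobenius S)%N.
Proof.
move=> [_ _ finS] SneT.
have ub x : gaps S x -> (x <= frobenius S)%N.
  move=> Sx; rewrite /frobenius; apply: (@leq_bigmax_seq _ _ predT id) => //.
  by rewrite in_fset_set // inE.
split=> //; have [y Sy] : exists y, gaps S y.
  apply: contrapT => noy; apply: SneT; apply/seteqP; split=> // x _.
  by apply: contrapT => nSx; apply: noy; exists x.
have : frobenius S \in fset_set (gaps S) \/ frobenius S = 0%N.
  rewrite /frobenius big_seq.
  elim/big_ind: _ => [|a b [ha|->] [hb|->]|i hi]; rewrite ?maxn0 ?max0n; auto.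
  by rewrite /maxn; case: ifP => _; left.
case; first by rewrite in_fset_set // inE.
move=> F0; have := ub _ Sy; rewrite F0 leqn0 => /eqP y0.
by rewrite -y0.
Qed.

Lemma finite_pseudo_frobenius (S : set nat) : numerical_semigroup S ->
  finite_set (pseudo_frobenius S).
Proof. by case=> _ _; apply: sub_finite_set => x []. Qed.

Lemma finite_semigroups_FT (F t : nat) : finite_set (semigroups_FT F t).
Proof.
pose f (A : {set 'I_F.+1}) : set nat := ~` [set val i | i in [set` A]].
apply: (@sub_finite_set _ _ (f @` setT)); last exact: finite_image.
move=> S [nS SneT FS _]; have [_ ub] := frobeniusP nS SneT; rewrite FS in ub.
exists [set i : 'I_F.+1 | `[< gaps S i >]]%SET => //.
rewrite /f; apply/seteqP; split=> x /= Sx.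
  apply: contrapT => gx; apply: Sx.
  have xF : (x < F.+1)%N by rewrite ltnS; exact: ub.
  by exists (Ordinal xF) => //=; rewrite inE; apply/asboolP.
by move=> [i /=]; rewrite inE => /asboolP gi ix; apply: gi; rewrite /= ix.
Qed.

(* Main.v *)
(* Fix m < F/2 and choose A inside ]F/3, m].  For every x in [1, m] put x in S
   when x is in A and F - x in S otherwise, add 0 and everything above F, and
   leave the window ]m, F - m[ out.  All nontrivial sums exceed 2F/3, so S is a
   semigroup, and its pseudo-Frobenius numbers are F and the window: S is almost
   symmetric of type F - 2m, and the choice of A is free.  This needs F and the
   type to have the same parity.  Otherwise leave out one more pair l, F - l
   with l just below F/3, while forcing F - 2l into A: then F - l is
   pseudo-Frobenius but l is not, as l + (F - 2l) = F - l, which changes the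
   parity of the type.  This gives the exponent F/6 - O(1) in both cases, better
   than F/10. *)

Require Import Defs.
From mathcomp Require Import all_boot all_order all_algebra finmap.
From mathcomp Require Import all_classical all_reals all_analysis.
From mathcomp Require Import zify lra.

Import Order.TTheory GRing.Theory Num.Theory.
Local Open Scope classical_set_scope.

Lemma ncard_seq (A : set nat) (s : seq nat) :
  uniq s -> (forall x, A x <-> x \in s) -> ncard A = size s.
Proof.
move=> us As; have fA : finite_set A.
  have -> : A = [set` s] by apply/seteqP; split=> x /As.
  exact: finite_seq.
rewrite /ncard; have -> : fset_set A = [fset x in s]%fset.
  apply/fsetP => x; rewrite in_fset_set // in_fset /=.
  by apply/idP/idP; rewrite inE => /As.
by rewrite card_fseq undup_id.
Qed.

Lemma leq_ncard_inj (I : finType) (A : set (set nat)) (f : I -> set nat) :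
  finite_set A -> injective f -> (forall i, A (f i)) -> #|I| <= ncard A.
Proof.
move=> fA injf Af; rewrite cardE -(size_map f); apply: uniq_leq_size.
  by rewrite map_inj_uniq // enum_uniq.
by move=> _ /mapP[i _ ->]; rewrite in_fset_set // inE.
Qed.

Lemma frobenius_eq (S : set nat) (F : nat) :
  numerical_semigroup S -> ~ S F -> (forall x, F < x -> S x) ->
  S <> setT /\ frobenius S = F.
Proof.
move=> nS SF up; have SneT : S <> setT by move=> ST; apply: SF; rewrite ST.
split=> //; have [gF ub] := frobeniusP nS SneT.
apply/eqP; rewrite eqn_leq ub // andbT leqNgt; apply/negP => /up.
exact: gF.
Qed.

(* For [1 <= x <= m] exactly one of [x], [F - x] is kept, according to [a],
   except that both [l] and [F - l] are gaps; [l = 0] means no exception. *)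
Definition mirror (F m l : nat) (a : pred nat) : set nat :=
  [set y | [|| y == 0, a y,
             [&& F <= y + m, y < F, ~~ a (F - y) & F - y != l] | F < y]].

(** All nonzero elements will be at least [c > F/3], so nontrivial sums start at [2c]; [adm_l] keeps
    the gap [F - l] below that. *)
Record admissible (F m c l : nat) (a : pred nat) : Prop := Admissible {
  adm_bounds : forall y, a y -> c <= y <= m;
  adm_cm : c <= m.+1;
  adm_m : m.*2 < F;
  adm_c : F < 3 * c;
  adm_lc : l < c;
  adm_l : 0 < l -> F < l + c.*2;
  adm_al : 0 < l -> a (F - l.*2) }.

(** * Closure, type and genus of mirror semigroups *)

Section Mirror.
Context {F m c l : nat} {a : pred nat} (H : admissible F m c l a).
Let S := mirror F m l a.

(** For [2c <= z < F], the mirror image [F - z] is at most [F - 2c < c], hence outside [a], and it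
    is below [l] when [l > 0]. *)
Lemma mirror_ge (z : nat) : c.*2 <= z -> z <> F -> S z.
Proof.
have [b ? ? ? ? hl _] := H.
by move=> cz zF; rewrite /S /mirror /=; have := b (F - z); lia.
Qed.

Lemma mirror_gap : ~ S F.
Proof.
by have [b ? ? ? ? ? _] := H; rewrite /S /mirror /= subnn; have := b F; lia.
Qed.

Lemma mirror_gt (z : nat) : F < z -> S z.
Proof. by rewrite /S /mirror /= => ->; rewrite !orbT. Qed.

Lemma mirror_add (x y : nat) : S x -> S y -> S (x + y).
Proof.
have [b cm mF Fc lc hl _] := H.
(* For nonzero [v] the sum is at least [2c], so only the value [F] must be avoided; [v = F - u] is
   not kept since [u] is in [a]. *)
have add_a u v : a u -> S v -> S (u + v).
  move=> au; have := b _ au => cum.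
  rewrite {1}/S /mirror /= => /or4P[/eqP -> | av | /and4P[? ? av ?] | ?].
  - by rewrite addn0 /S /mirror /= au orbT.
  - by have := b _ av => ?; apply: mirror_ge; lia.
  - apply: mirror_ge; first by lia.
    by move=> uvF; move: av; rewrite -uvF addnK au.
  - by apply: mirror_ge; lia.
move=> Sx Sy; have [ax|nax] := boolP (a x); first exact: add_a.
have [ay|nay] := boolP (a y); first by rewrite addnC; apply: add_a.
have [x0|x0] := eqVneq x 0; first by rewrite x0.
have [y0|y0] := eqVneq y 0; first by rewrite y0 addn0.
(* Both summands are now at least [F - m > F/2]. *)
by apply: mirror_gt; move: Sx Sy; rewrite /S /mirror /=; lia.
Qed.

Lemma mirror_semigroup : numerical_semigroup S.
Proof.
split; [by [] | exact: mirror_add |].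
apply: (@sub_finite_set _ _ `I_F.+1); last exact: finite_II.
by move=> x /= gx; rewrite ltnS leqNgt; apply/negP => /mirror_gt.
Qed.

(* The gap [l] is not pseudo-Frobenius since [F - 2 l] is in [S]. *)
Lemma pseudo_frobenius_mirror (x : nat) : pseudo_frobenius S x <->
  x \in F :: iota m.+1 (F - m.*2.+1) ++ nseq (0 < l) (F - l).
Proof.
have [b cm mF Fc lc hl al] := H.
rewrite inE mem_cat mem_iota mem_nseq; split.
  move=> [gx pfx]; have [//|xF] := eqVneq x F.
  have xF' : x < F.
    by rewrite ltnNge leq_eqVlt eq_sym (negbTE xF); apply/negP => /mirror_gt.
  have gFx : ~ S (F - x).
    move=> SFx; apply: mirror_gap; rewrite -(subnKC (ltnW xF')).
    by apply: pfx => //; lia.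
  have [xl|xl] := eqVneq x l.
    have [l0|l0] := posnP l; first by case: gx; rewrite xl l0.
    have Fl : S (F - l).
      have -> : F - l = x + (F - l.*2) by lia.
      have := al l0 => als; have := b _ als => bs.
      by apply: pfx; [rewrite /S /mirror /= als orbT | lia].
    by case: gFx; rewrite xl.
  move: gx gFx; rewrite /gaps /S /mirror /=.
  have -> : F - (F - x) = x by lia.
  have := b x; lia.
move=> xin; have x0 : m < x <= F by lia.
split.
  move: xin; rewrite /gaps /S /mirror /=.
  have := b x; have := b (F - x); lia.
(* Here [s >= c] and [x > m >= c - 1], so [x + s >= 2c]. *)
move=> s Ss s0; apply/mirror_ge; last first.
  move=> xsF; move: Ss xin; have -> : x = F - s by lia.
  rewrite /S /mirror /=; have := b s; lia.
by move: Ss; rewrite /S /mirror /=; have := b s; lia.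
Qed.

Lemma semigroup_type_mirror : semigroup_type S = F - m.*2 + (0 < l).
Proof.
have [b cm mF Fc lc hl al] := H.
rewrite /semigroup_type (ncard_seq _ _ _ pseudo_frobenius_mirror).
  by rewrite /= size_cat size_iota size_nseq; lia.
have [l0|l0] := ltnP 0 l; rewrite cons_uniq cat_uniq iota_uniq mem_cat /=.
  by rewrite inE !mem_iota; lia.
by rewrite in_nil mem_iota; lia.
Qed.

(** Each pair [y], [F - y] with [0 <= y <= m] has exactly one gap, [g y]; the window adds
    [F - 2m - 1] more. *)
Lemma genus_mirror : l = 0 -> genus S = F - m.
Proof.
have [b cm mF Fc lc hl al] := H; move=> l0.
pose g y := if (y == 0) || a y then F - y else y.
have gE x : gaps S x <->
    x \in map g (iota 0 m.+1) ++ iota m.+1 (F - m.*2.+1).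
  rewrite mem_cat mem_iota; split.
    move=> gx; have xF : x <= F by rewrite leqNgt; apply/negP => /mirror_gt.
    case: (leqP x m) => xm.
      apply/orP; left; apply/mapP; exists x; first by rewrite mem_iota; lia.
      by move: gx; rewrite /g /S /gaps /mirror /=; case: ifP; lia.
    case: (ltnP x (F - m)) => xFm; first by lia.
    apply/orP; left; apply/mapP; exists (F - x); first by rewrite mem_iota; lia.
    by move: gx; rewrite /g /S /gaps /mirror /=; case: ifP; lia.
  case/orP=> [/mapP[y]|].
    rewrite mem_iota /g => ym ->; rewrite /gaps /S /mirror /=.
    case: ifP => ay; have := b (F - y); have := b (F - (F - y)); last by lia.
    have -> : F - (F - y) = y by lia.
    by lia.
  by move=> xm; rewrite /gaps /S /mirror /=; have := b x; lia.
rewrite /genus (ncard_seq _ _ _ gE).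
  by rewrite size_cat size_map !size_iota; lia.
rewrite cat_uniq iota_uniq andbT; apply/andP; split.
  rewrite map_inj_in_uniq ?iota_uniq // => x y; rewrite !mem_iota /g.
  by do 2 case: ifP => _; lia.
apply/hasPn => x; rewrite mem_iota => xm; apply/mapP => -[y].
by rewrite mem_iota /g; case: ifP => _; lia.
Qed.

Lemma mirror_FT : semigroups_FT F (F - m.*2 + (0 < l)) S.
Proof.
have [SneT FS] := frobenius_eq _ _ mirror_semigroup mirror_gap mirror_gt.
by split; [exact: mirror_semigroup | | | exact: semigroup_type_mirror].
Qed.

Lemma almost_symmetric_mirror : l = 0 -> almost_symmetric S.
Proof.
have [b cm mF Fc lc hl al] := H; move=> l0.
have [_ _ FS tS] := mirror_FT.
by rewrite /almost_symmetric tS FS genus_mirror // l0; lia.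
Qed.

(** Mirrored elements are at least [F - m > m], so [a] can be recovered from the semigroup. *)
Lemma mirror_low (y : nat) : c <= y <= m -> S y -> a y.
Proof. by have [b ? ? ? ? ? ?] := H; rewrite /S /mirror /=; lia. Qed.

End Mirror.

(** * Families indexed by subsets *)

Definition shifted {n : nat} (d : nat) (U : {set 'I_n}) : pred nat :=
  fun y => [exists i in U, y == d + i].

Lemma shifted_bounds (n d y : nat) (U : {set 'I_n}) :
  shifted d U y -> d <= y < d + n.
Proof. by case/exists_inP => i _ /eqP ->; have := ltn_ord i; lia. Qed.

Lemma shifted_mem (n d : nat) (U : {set 'I_n}) (i : 'I_n) :
  shifted d U (d + i) = (i \in U).
Proof.
apply/exists_inP/idP => [[j jU]|iU]; last by exists i.
by rewrite eqn_add2l => /eqP/val_inj ->.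
Qed.

Lemma mirror_family (F m c l n : nat) :
  m.*2 < F -> F < 3 * c -> l < c -> (0 < l -> F = c + l.*2) ->
  c + (0 < l) + n <= m.+1 ->
  exists f : {set 'I_n} -> set nat, injective f /\
    forall U, semigroups_FT F (F - m.*2 + (0 < l)) (f U) /\
              (l = 0 -> almost_symmetric (f U)).
Proof.
(* When [l > 0], the forced element [F - 2l] is [c] itself, so the free choices start at [c + 1]. *)
move=> mF Fc lc Fcl cnm; pose d := c + (0 < l).
pose a (U : {set 'I_n}) y := (0 < l) && (y == c) || shifted d U y.
have adm U : admissible F m c l (a U).
  split; rewrite /a; try lia.
  by move=> y; have := @shifted_bounds n d y U; rewrite /d; lia.
exists (fun U => mirror F m l (a U)); split; last first.
  by move=> U; split; [exact: mirror_FT (adm U)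
                      | exact: almost_symmetric_mirror (adm U)].
have sub U V : mirror F m l (a U) = mirror F m l (a V) -> U \subset V.
  move=> UV; apply/fintype.subsetP => i iU.
  have aU : a U (d + i) by rewrite /a shifted_mem iU orbT.
  have : a V (d + i).
    apply: (mirror_low (adm V)); first exact: adm_bounds (adm U) _ aU.
    by rewrite -UV /mirror /= aU orbT.
  rewrite /a shifted_mem /d; case: (i \in V); rewrite ?orbF //; lia.
by move=> U V UV; apply/eqP; rewrite finset.eqEsubset !sub.
Qed.

(** * Lower bounds for [T1] and [T] *)

Lemma T1_ge (alpha F : nat) :
  0 < alpha -> 3 * alpha < F -> F = alpha %[mod 2] ->
  2 ^ ((F - alpha) %/ 2 - F %/ 3) <= T1 F alpha.
Proof.
move=> a0 Fa Fmod; pose m := (F - alpha) %/ 2.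
(* The free elements are those of []F/3, m]], and equal parity gives [F - 2m = alpha]. *)
have [||||| f [injf fP]] := @mirror_family F m (F %/ 3).+1 0 (m - F %/ 3);
  rewrite ?/m; try lia.
have -> : 2 ^ ((F - alpha) %/ 2 - F %/ 3) = #|{set 'I_(m - F %/ 3)}|.
  by rewrite -cardsT -powersetT card_powerset cardsT card_ord.
apply: leq_ncard_inj injf _.
  by apply: sub_finite_set (finite_semigroups_FT F alpha) => S [].
move=> U; have [fU asU] := fP U; split; last exact: asU.
by move: fU; congr (semigroups_FT _ _ _); rewrite /m; lia.
Qed.

Lemma T1_leq_T (F t : nat) : T1 F t <= T F t.
Proof.
apply: fsubset_leq_card; rewrite -fset_set_sub; first by move=> S [].
  by apply: sub_finite_set (finite_semigroups_FT F t) => S [].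
exact: finite_semigroups_FT.
Qed.

Lemma T_ge (alpha F : nat) :
  1 < alpha -> 3 * alpha + 6 < F -> F <> alpha %[mod 2] ->
  2 ^ ((F - alpha) %/ 2 - F %/ 3 - 1) <= T F alpha.
Proof.
(* Opposite parity gives [F - 2m = alpha - 1], positive as [alpha > 1]; the pseudo-Frobenius number
   [F - l] supplies the missing one. This [l] is the largest with [3l < F], which makes [c = F - 2l]
   exceed both [l] and [F/3]. *)
move=> a1 Fa Fmod; pose m := (F - alpha).+1 %/ 2; pose l := F.-1 %/ 3.
pose n := (F - alpha) %/ 2 - F %/ 3 - 1.
have [||||| f [injf fP]] := @mirror_family F m (F - l.*2) l n;
  rewrite ?/m ?/l ?/n; try lia.
have -> : 2 ^ ((F - alpha) %/ 2 - F %/ 3 - 1) = #|{set 'I_n}|.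
  by rewrite -cardsT -powersetT card_powerset cardsT card_ord.
apply: leq_ncard_inj injf _; first exact: finite_semigroups_FT.
move=> U; have [+ _] := fP U.
by congr (semigroups_FT _ _ _); rewrite /m /l; lia.
Qed.

Local Open Scope ring_scope.

Theorem theorem1p8 (R : realType) :
  (forall alpha F : nat,
     (0 < alpha)%N -> (3 * alpha + 3 < F)%N -> F = alpha %[mod 2] ->
     (2 : R) `^ (F%:R / 6 - alpha%:R / 2) <= (T1 F alpha)%:R)
  /\
  (forall (alpha : nat) (eps : R),
     (2 <= alpha)%N -> 0 < eps ->
     \forall F \near \oo, (2 : R) `^ ((1 / 10 - eps) * F%:R) < (T F alpha)%:R).
Proof.
have pow_le (x : R) (n k : nat) : x <= n%:R -> (2 ^ n <= k)%N ->
    (2 : R) `^ x <= k%:R.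
  move=> xn nk; apply: (@le_trans _ _ (2 `^ n%:R)).
    by apply: ler_powR; rewrite ?ler1n.
  by rewrite powR_mulrn // -natrX ler_nat.
split.
  move=> alpha F a0 Fa Fmod; apply: pow_le (T1_ge _ _ a0 _ Fmod); last by lia.
  (* Equal parity makes the halving exact, and rounding [F/3] down only helps. *)
  have : (F <= 6 * ((F - alpha) %/ 2 - F %/ 3) + 3 * alpha)%N by lia.
  by rewrite -(ler_nat R) natrD !natrM; lra.
(* After rounding, the exponent is at least [F/6 - (alpha + 3)/2], which is at least [F/10] once
   [F >= 15(alpha + 3)/2]; the threshold is twice that. *)
move=> alpha eps a2 e0; exists (15 * alpha + 45)%N => // F /= FN.
apply: (@lt_le_trans _ _ (2 `^ (F%:R / 10))).
  rewrite /powR pnatr_eq0 /= ltr_expR ltr_pM2r ?ln_gt0 ?ltr1n //.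
  have : (0 < F)%N by lia.
  by rewrite -(ltr_nat R); nra.
have bnd : (2 ^ ((F - alpha) %/ 2 - F %/ 3 - 1) <= T F alpha)%N.
  have [Fmod|/eqP Fmod] := eqVneq (F %% 2)%N (alpha %% 2)%N; last first.
    by apply: T_ge => //; lia.
  apply: leq_trans (leq_trans (T1_ge _ _ _ _ Fmod) (T1_leq_T _ _)); try lia.
  by rewrite leq_exp2l //; lia.
apply: pow_le bnd.
have : (F <= 10 * ((F - alpha) %/ 2 - F %/ 3 - 1))%N by lia.
by rewrite -(ler_nat R) natrM; lra.
Qed.
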